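(* Let $n\ge 1$ and let $f:\mathbf{M}^n\to\mathbb{R}$ be submodular with $f(\mathbf{0}_{\mathbf{M}^n})=0$. Then \[ \min_{\mathbf{t}\in\mathbf{M}^n} f(\mathbf{t}) = \max\left\{\mathbf{z}(\mathbf{1}_{\mathbf{M}^n}) \;\middle|\; \mathbf{z}\in P_M(f),\ \mathbf{z}\le 0,\ \mathbf{z}\text{ unified}\right\} = \max\left\{\mathbf{x}^-(\mathbf{1}_{\mathbf{M}^n}) \;\middle|\; \mathbf{x}\in B_M(f),\ \mathbf{x}^-\text{ unified}\right\}. \]
   Context: Let $\mathbf{M}$ be a diamond: elements a bottom $0_M$, a top $1_M$, and a finite set $A$ of atoms with $|A|\ge3$, $0_M<a<1_M$ for all $a\in A$, distinct atoms incomparable. $\mathbf{M}^n$ is the product lattice (coordinatewise), with bottom $\mathbf{0}_{\mathbf{M}^n}$ and top $\mathbf{1}_{\mathbf{M}^n}$. $f$ is submodular if $f(\mathbf{s}\wedge\mathbf{t})+f(\mathbf{s}\vee\mathbf{t})\le f(\mathbf{s})+f(\mathbf{t})$ for all $\mathbf{s},\mathbf{t}$. For $\mathbf{x}\in\mathbb{R}^{[n]\times A}$: $\mathbf{x}\le0$ means all entries are $\le0$; $\mathbf{x}^-$ is the vector with $\mathbf{x}^-(i,a)=\min\{0,\mathbf{x}(i,a)\}$. For $\mathbf{y}\in\mathbf{M}^n$, $\mathbf{x}(\mathbf{y})=\sum_{i=1}^n g_i$ with $g_i=0$ if $\mathbf{y}(i)=0_M$, $g_i=\mathbf{x}(i,\mathbf{y}(i))$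 if $\mathbf{y}(i)\in A$, $g_i=\max_{a\ne a'\in A}(\mathbf{x}(i,a)+\mathbf{x}(i,a'))$ if $\mathbf{y}(i)=1_M$. $P_M(f)=\{\mathbf{x}\mid \mathbf{x}(\mathbf{y})\le f(\mathbf{y})\ \forall\mathbf{y}\in\mathbf{M}^n\}$ and $B_M(f)=\{\mathbf{x}\in P_M(f)\mid \mathbf{x}(\mathbf{1}_{\mathbf{M}^n})=f(\mathbf{1}_{\mathbf{M}^n})\}$. A vector $\mathbf{x}$ is unified if for each $i\in[n]$ there is $p\in A$ with $\mathbf{x}(i,a)=\mathbf{x}(i,b)$ for all $a,b\in A\setminus\{p\}$ and $\mathbf{x}(i,p)\ge\mathbf{x}(i,a)$ for all $a\in A$. *)

(* Defs.v *)
From HB Require Import structures.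
From mathcomp Require Import all_boot all_order all_algebra.
From mathcomp Require Import boolp classical_sets reals.

Set Implicit Arguments.
Unset Strict Implicit.
Unset Printing Implicit Defensive.

Import Order.TTheory GRing.Theory Num.Theory.

Local Open Scope ring_scope.
Local Open Scope classical_set_scope.

Inductive diamond (A : Type) : Type := DBot | DAtom of A | DTop.
Arguments DBot {A}.
Arguments DTop {A}.

Section DiamondLattice.
Variable A : finType.
Local Notation M := (diamond A).
Implicit Types x y z : M.

Definition diamond_to_option x : option (option A) :=
  match x with DBot => None | DAtom a => Some (Some a) | DTop => Some None end.

Definition diamond_of_option (o : option (option A)) : M :=
  match o with None => DBot | Some (Some a) => DAtom a | Some None => DTop end.

Lemma diamond_to_optionK : cancel diamond_to_option diamond_of_option.
Proof. by case. Qed.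

HB.instance Definition _ := Finite.copy M (can_type diamond_to_optionK).

Definition diamond_le x y : bool :=
  match x, y with
  | DBot, _ | _, DTop => true
  | DAtom a, DAtom b => a == b
  | _, _ => false
  end.

Definition diamond_meet x y : M :=
  match x, y with
  | DTop, z | z, DTop => z
  | DAtom a, DAtom b => if a == b then DAtom a else DBot
  | _, _ => DBot
  end.

Definition diamond_join x y : M :=
  match x, y with
  | DBot, z | z, DBot => z
  | DAtom a, DAtom b => if a == b then DAtom a else DTop
  | _, _ => DTop
  end.

Fact diamond_le_refl : reflexive diamond_le.
Proof. by case=> //= a; exact: eqxx. Qed.

Fact diamond_le_anti : antisymmetric diamond_le.
Proof. by case=> [|a|] [|b|] //= /andP[/eqP->]. Qed.

Fact diamond_le_trans : transitive diamond_le.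
Proof. by case=> [|b|] [|a|] [|c|] //= /eqP->. Qed.

Fact diamond_display : Order.disp_t. Proof. exact: (Order.Disp tt tt). Qed.

HB.instance Definition _ := Order.Le_isPOrder.Build diamond_display M
  diamond_le_refl diamond_le_anti diamond_le_trans.

Fact diamond_meetP x y z :
  (x <= diamond_meet y z)%O = (x <= y)%O && (x <= z)%O.
Proof.
rewrite /Order.le /=.
case: x y z => [|a|] [|b|] [|c|] //=; rewrite ?andbT ?andbF //; try by case: ifP.
case: (eqVneq b c) => [<-|nbc] /=; first by rewrite andbb.
by case: (eqVneq a b) => // ->; rewrite (negPf nbc).
Qed.

Fact diamond_joinP x y z :
  (diamond_join x y <= z)%O = (x <= z)%O && (y <= z)%O.
Proof.
rewrite /Order.le /=.
case: x y z => [|a|] [|b|] [|c|] //=; rewrite ?andbT ?andbF //; try by case: ifP.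
case: (eqVneq a b) => [<-|nab] /=; first by rewrite andbb.
by case: (eqVneq a c) nab => // ->; rewrite eq_sym => /negPf->.
Qed.

HB.instance Definition _ := Order.POrder_MeetJoin_isLattice.Build
  diamond_display M diamond_meetP diamond_joinP.

Fact diamond_le0x x : (DBot <= x)%O.
Proof. by []. Qed.

Fact diamond_lex1 x : (x <= DTop)%O.
Proof. by case: x. Qed.

HB.instance Definition _ :=
  Order.hasBottom.Build diamond_display M diamond_le0x.
HB.instance Definition _ :=
  Order.hasTop.Build diamond_display M diamond_lex1.

End DiamondLattice.

Definition submodular (R : realType) (d : Order.disp_t) (L : latticeType d)
    (f : L -> R) : Prop :=
  forall s t : L, f (s `&` t)%O + f (s `|` t)%O <= f s + f t.

Section Polyhedra.
Variables (R : realType) (A : finType) (n : nat).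
Local Notation vec := {ffun 'I_n * A -> R}.
(* [n.-tupleprod] carries the coordinatewise order (and not the lexicographic
   one), so Order.meet, Order.join, \bot and \top act coordinatewise. *)
Local Notation Mn := (n.-tupleprod (diamond A)).
Implicit Types (x : vec) (y : Mn) (f : Mn -> R).

Definition pair_sums (u : A -> R) : seq R :=
  [seq u p.1 + u p.2 | p <- enum {: A * A} & p.1 != p.2].

(* The initial value of the iterated maximum is itself one of the pair sums as
   soon as A has two elements, so that the result is the maximum of the sums
   even when they are all negative. *)
Definition max_pair_sum (u : A -> R) : R :=
  \big[Num.max/head 0 (pair_sums u)]_(v <- pair_sums u) v.

Lemma max_pair_sumP (u : A -> R) : (2 <= #|A|)%N ->
  (exists a b : A, a != b /\ max_pair_sum u = u a + u b) /\
  (forall a b : A, a != b -> u a + u b <= max_pair_sum u).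
Proof.
have memP v : reflect (exists a b : A, a != b /\ v = u a + u b)
    (v \in pair_sums u).
  apply: (iffP mapP) => [[[a b]]|[a [b [nab ->]]]].
    by rewrite mem_filter => /andP[nab _] ->; exists a, b.
  by exists (a, b); rewrite // mem_filter mem_enum andbT.
move=> /card_gt1P[a0 [b0 [_ _ nab0]]].
have s0 : u a0 + u b0 \in pair_sums u by apply/memP; exists a0, b0.
split=> [|a b nab]; last first.
  rewrite /max_pair_sum; apply: (@le_bigmax_seq _ _ _ _ _ (u a + u b) xpredT id) => //.
  by apply/memP; exists a, b.
apply/memP; rewrite /max_pair_sum.
have h0 : head 0 (pair_sums u) \in pair_sums u.
  by case: (pair_sums u) s0 => //= v s _; rewrite mem_head.
rewrite big_seq; elim/big_ind: _ => // v w vs ws.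
by rewrite /Num.max; case: ifP.
Qed.

Definition vec_at x (i : 'I_n) (m : diamond A) : R :=
  match m with
  | DBot => 0
  | DAtom a => x (i, a)
  | DTop => max_pair_sum (fun a => x (i, a))
  end.

Definition vec_eval x y : R := \sum_(i < n) vec_at x i (tnth y i).

Definition nonpositive x : Prop := forall ia, x ia <= 0.

Definition neg_part x : vec := [ffun ia => Num.min 0 (x ia)].

Definition polyM f : set vec := [set x | forall y : Mn, vec_eval x y <= f y].

Definition baseM f : set vec :=
  [set x | polyM f x /\ vec_eval x (\top)%O = f (\top)%O].

Definition unified x : Prop :=
  forall i : 'I_n, exists p : A,
    (forall a b : A, a != p -> b != p -> x (i, a) = x (i, b)) /\
    (forall a : A, x (i, a) <= x (i, p)).

End Polyhedra.

Definition is_minimum (R : realType) (S : set R) (m : R) : Prop :=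
  S m /\ lbound S m.

Definition is_maximum (R : realType) (S : set R) (m : R) : Prop :=
  S m /\ ubound S m.

(* Main.v *)
Require Import Defs.
From HB Require Import structures.
From mathcomp Require Import all_boot all_order all_algebra.
From mathcomp Require Import boolp classical_sets reals.
From mathcomp Require Import lra.

Set Implicit Arguments.
Unset Strict Implicit.
Unset Printing Implicit Defensive.

Import Order.TTheory GRing.Theory Num.Theory.

Local Open Scope ring_scope.
Local Open Scope classical_set_scope.

(** Let [t] minimise [f], and put [fl s := min_(u <= s) f u] and
    [fu s := min_(s <= u) f u]: both are submodular, [fl] is antitone, [fu] is
    isotone, and both agree with [f] at [t]. By submodularity
    [f y >= fl (y /\ t) + fu (y \/ t) - f t]. The greedy algorithm along a chain
    from [\bot] to [t] for [fl] and along one from [t] to [\top] for [fu] bounds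
    the right-hand side from below by a sum of one-coordinate functions, with
    equality at [\top]. In each coordinate this leaves a problem on a single
    diamond, solved by a vector with one peak value and all other values equal.
    The resulting [x] lies in the base polyhedron, its negative part is unified
    and evaluates to [f t] at [\top], and [neg_part x] is the maximiser of the
    first maximum. *)

(** * Monotone envelopes of a submodular function *)

Section MonotoneEnvelopes.
Variables (R : realType) (d : Order.disp_t) (L : finTBLatticeType d).
Variable f : L -> R.

(** The default [\bot] is below every [s], so the argmin ranges over a nonempty set; [\top] serves
    the same purpose in [upper_envelope]. *)
Definition lower_envelope (s : L) : R :=
  f [arg min_(u < \bot%O | (u <= s)%O) f u]%O.

Definition upper_envelope (s : L) : R :=
  f [arg min_(u < \top%O | (s <= u)%O) f u]%O.

Lemma lower_envelopeP s :
  exists2 u, (u <= s)%O & lower_envelope s = f u /\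
    forall v, (v <= s)%O -> lower_envelope s <= f v.
Proof.
rewrite /lower_envelope; case: arg_minP => [|u us umin]; first exact: le0x.
by exists u.
Qed.

Lemma upper_envelopeP s :
  exists2 u, (s <= u)%O & upper_envelope s = f u /\
    forall v, (s <= v)%O -> upper_envelope s <= f v.
Proof.
rewrite /upper_envelope; case: arg_minP => [|u us umin]; first exact: lex1.
by exists u.
Qed.

Lemma lower_envelope_anti s t :
  (s <= t)%O -> lower_envelope t <= lower_envelope s.
Proof.
move=> st; have [u us [-> _]] := lower_envelopeP s.
have [v _ [_ vmin]] := lower_envelopeP t.
exact/vmin/(le_trans us).
Qed.

Lemma upper_envelope_homo s t :
  (s <= t)%O -> upper_envelope s <= upper_envelope t.
Proof.
move=> st; have [u us [-> _]] := upper_envelopeP t.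
have [v _ [_ vmin]] := upper_envelopeP s.
exact/vmin/(le_trans st).
Qed.

Lemma lower_envelope_le s : lower_envelope s <= f s.
Proof. by have [u _ [_ ->]] := lower_envelopeP s. Qed.

Lemma upper_envelope_le s : upper_envelope s <= f s.
Proof. by have [u _ [_ ->]] := upper_envelopeP s. Qed.

Lemma lower_envelope_bot : lower_envelope \bot%O = f \bot%O.
Proof.
by have [u] := lower_envelopeP \bot%O; rewrite lex0 => /eqP -> [].
Qed.

Lemma upper_envelope_top : upper_envelope \top%O = f \top%O.
Proof.
by have [u] := upper_envelopeP \top%O; rewrite le1x => /eqP -> [].
Qed.

(** Minimisers [u] below [s] and [v] below [t] have a meet and a join that compete at the meet and
    the join of [s] and [t]. *)
Lemma lower_envelope_submodular : submodular f -> submodular lower_envelope.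
Proof.
move=> sf s t; have [u us [-> _]] := lower_envelopeP s.
have [v vt [-> _]] := lower_envelopeP t.
apply: le_trans (sf u v); apply: lerD.
  by have [w _ [_ ->]] := lower_envelopeP (s `&` t)%O; rewrite ?leI2.
by have [w _ [_ ->]] := lower_envelopeP (s `|` t)%O; rewrite ?leU2.
Qed.

Lemma upper_envelope_submodular : submodular f -> submodular upper_envelope.
Proof.
move=> sf s t; have [u us [-> _]] := upper_envelopeP s.
have [v vt [-> _]] := upper_envelopeP t.
apply: le_trans (sf u v); apply: lerD.
  by have [w _ [_ ->]] := upper_envelopeP (s `&` t)%O; rewrite ?leI2.
by have [w _ [_ ->]] := upper_envelopeP (s `|` t)%O; rewrite ?leU2.
Qed.

End MonotoneEnvelopes.

(** * Greedy bounds along a chain in a product lattice *)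

Section Greedy.
Variables (R : realType) (d : Order.disp_t) (T : latticeType d) (n : nat).
Local Notation Tn := (n.-tupleprod T).
Variables (F : Tn -> R) (b c : Tn).
Hypothesis sF : submodular F.

(** For [b <= y <= c] this is the meet of [y] with the [k]-th point of the chain that raises the
    coordinates from [b] to [c] one at a time. *)
Definition chain_point (k : nat) (y : Tn) : Tn :=
  [tuple if (i < k)%N then tnth y i else tnth b i | i < n].

Definition chain_step (k : 'I_n) (m : T) : Tn :=
  [tuple if (i < k)%N then tnth c i else if i == k then m else tnth b i
     | i < n].

Definition marginal (k : 'I_n) (m : T) : R :=
  F (chain_step k m) - F (chain_step k (tnth b k)).

Lemma tuple_leP (s t : Tn) :
  reflect (forall i, (tnth s i <= tnth t i)%O) (s <= t)%O.
Proof. by rewrite leEtprod; exact: forallP. Qed.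

Lemma chain_step_bottom k : chain_step k (tnth b k) = chain_point k c.
Proof.
apply: eq_from_tnth => i; rewrite !tnth_mktuple.
by case: ifP => // _; case: eqP => [->|].
Qed.

Lemma chain_step_top k : chain_step k (tnth c k) = chain_point k.+1 c.
Proof.
apply: eq_from_tnth => i; rewrite !tnth_mktuple ltnS [in RHS]leq_eqVlt val_eqE.
by case: eqVneq => [->|_] /=; rewrite ?ltnn.
Qed.

Lemma chain_pointT y : chain_point n y = y.
Proof. by apply: eq_from_tnth => i; rewrite tnth_mktuple ltn_ord. Qed.

Lemma chain_point0 y : chain_point 0 y = b.
Proof. by apply: eq_from_tnth => i; rewrite tnth_mktuple. Qed.

Lemma marginal_bottom k : marginal k (tnth b k) = 0.
Proof. exact: subrr. Qed.

Lemma chain_step_homo k m m' :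
  (m <= m')%O -> (chain_step k m <= chain_step k m')%O.
Proof.
move=> mm; apply/tuple_leP => i; rewrite !tnth_mktuple.
by case: ifP => // _; case: ifP.
Qed.

(** [chain_step k] preserves meets and joins, and the subtracted constant cancels. *)
Lemma marginal_submodular k : submodular (marginal k).
Proof.
move=> m m'; have := sF (chain_step k m) (chain_step k m').
have -> : (chain_step k m `&` chain_step k m' = chain_step k (m `&` m'))%O.
  apply: eq_from_tnth => i; rewrite tnth_meet !tnth_mktuple.
  by case: ifP; rewrite ?meetxx //; case: ifP; rewrite ?meetxx.
have -> : (chain_step k m `|` chain_step k m' = chain_step k (m `|` m'))%O.
  apply: eq_from_tnth => i; rewrite tnth_join !tnth_mktuple.
  by case: ifP; rewrite ?joinxx //; case: ifP; rewrite ?joinxx.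
by rewrite /marginal; lra.
Qed.

(** Diminishing returns: raising coordinate [k] gains no more when the earlier coordinates are
    already at [c] than when they are at [y]. *)
Lemma marginal_le y (k : 'I_n) : (b <= y)%O -> (y <= c)%O ->
  marginal k (tnth y k) <= F (chain_point k.+1 y) - F (chain_point k y).
Proof.
move=> /tuple_leP by_ /tuple_leP yc;
have := sF (chain_point k.+1 y) (chain_point k c).
have -> : (chain_point k.+1 y `&` chain_point k c = chain_point k y)%O.
  apply: eq_from_tnth => i; rewrite tnth_meet !tnth_mktuple ltnS.
  case: (ltngtP i k) => // _; first exact: meet_l.
    exact: meetxx.
  exact: meet_r.
have -> : (chain_point k.+1 y `|` chain_point k c = chain_step k (tnth y k))%O.
  apply: eq_from_tnth => i; rewrite tnth_join !tnth_mktuple ltnS.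
  rewrite -val_eqE.
  case: (ltngtP i k) => [_|_|/val_inj ->]; first exact: join_r.
    exact: joinxx.
  exact: join_l.
by rewrite /marginal chain_step_bottom; lra.
Qed.

Lemma sum_chain_point y :
  \sum_(k < n) (F (chain_point k.+1 y) - F (chain_point k y)) = F y - F b.
Proof.
rewrite -(big_mkord xpredT
  (fun k => F (chain_point k.+1 y) - F (chain_point k y))).
by rewrite telescope_sumr // chain_pointT chain_point0.
Qed.

Lemma sum_marginal_le y : (b <= y)%O -> (y <= c)%O ->
  \sum_(k < n) marginal k (tnth y k) <= F y - F b.
Proof.
move=> by_ yc; rewrite -sum_chain_point; apply: ler_sum => k _.
exact: marginal_le.
Qed.

Lemma sum_marginal_top : \sum_(k < n) marginal k (tnth c k) = F c - F b.
Proof.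
rewrite -sum_chain_point; apply: eq_bigr => k _.
by rewrite /marginal chain_step_bottom chain_step_top.
Qed.

End Greedy.

(** * The problem on a single diamond *)

Section OneCoordinate.
Variables (R : realType) (A : finType).
Hypothesis hA : (3 <= #|A|)%N.
Implicit Types (g : diamond A -> R) (p q a : A) (t m : diamond A).

Let hA2 : (2 <= #|A|)%N := ltnW hA.

Lemma atom_neq q : exists p, p != q.
Proof.
have /card_gt1P[a [b [_ _ ab]]] := hA2.
by case: (eqVneq a q) ab => [->|]; [exists b; rewrite eq_sym | exists a].
Qed.

Lemma diamond_meetE (x y : diamond A) : (x `&` y)%O = diamond_meet x y.
Proof. by []. Qed.

Lemma diamond_joinE (x y : diamond A) : (x `|` y)%O = diamond_join x y.
Proof. by []. Qed.

Lemma submodular_atoms g p q : submodular g -> p != q ->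
  g DBot + g DTop <= g (DAtom p) + g (DAtom q).
Proof.
move=> sg /negPf pq; have := sg (DAtom p) (DAtom q).
by rewrite diamond_meetE diamond_joinE /= pq.
Qed.

(* The split of [g DTop] is at an atom [q] minimising [g]; whichever of the two
   parts is larger becomes the peak value [alpha], at [q] itself or elsewhere. *)
Lemma peak_of_submodular g : submodular g -> g DBot = 0 ->
  exists p q alpha beta,
    [/\ beta <= alpha, alpha <= g (DAtom p),
        forall a, a != p -> beta <= g (DAtom a)
      & (alpha, beta) = (g (DAtom q), g DTop - g (DAtom q)) \/
        (alpha, beta) = (g DTop - g (DAtom q), g (DAtom q))].
Proof.
move=> sg g0; have /card_gt0P[a0 _] := ltnW hA2.
pose q := [arg min_(a < a0) g (DAtom a)]%O.
have qmin a : g (DAtom q) <= g (DAtom a).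
  by rewrite /q; case: arg_minP => // i _; apply.
have gle a : a != q -> g DTop - g (DAtom q) <= g (DAtom a).
  by move=> /(submodular_atoms sg); rewrite g0; lra.
have [le_q|lt_q] := leP (g DTop - g (DAtom q)) (g (DAtom q)).
  by exists q, q, (g (DAtom q)), (g DTop - g (DAtom q)); split=> //; left.
(* The larger part now exceeds the minimum [g (DAtom q)], so it must sit at an atom other than [q],
   where [gle] bounds it. *)
have [p pq] := atom_neq q.
exists p, q, (g DTop - g (DAtom q)), (g (DAtom q)); split=> //; last by right.
  exact: ltW.
exact: gle.
Qed.

(** If [t] is the bottom, [h] is [g2] and both values are nonnegative; if [t] is the top, [h] is
    [g1] and both are nonpositive. So the negative parts add up to [0] or to [g1 DTop], as
    required. *)
Lemma peak_of_pair g1 g2 t :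
    submodular g1 -> submodular g2 ->
    {homo g1 : x y / (x <= y)%O >-> y <= x} ->
    {homo g2 : x y / (x <= y)%O >-> x <= y} ->
    g1 DBot = 0 -> g2 t = 0 ->
  let h m := g1 (m `&` t)%O + g2 (m `|` t)%O in
  exists p alpha beta,
    [/\ beta <= alpha, alpha <= h (DAtom p),
        forall a, a != p -> beta <= h (DAtom a),
        alpha + beta = h DTop
      & Num.min 0 alpha + Num.min 0 beta = g1 t].
Proof.
move=> s1 s2 m1 m2 g10 g2t h.
have hE m : h m = g1 (diamond_meet m t) + g2 (diamond_join m t) by [].
have ha1 a : g1 DTop <= g1 (DAtom a) <= 0.
  by rewrite -g10 !m1.
have ha2 a : g2 DBot <= g2 (DAtom a) <= g2 DTop by rewrite !m2.
case: t => [|q|] in g2t h hE *.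
- have [p [q [al [be [ba alp bea def]]]]] := peak_of_submodular s2 g2t.
  have := ha2 q; rewrite g2t => /andP[q0 q1].
  exists p, al, be; split=> // [|a ap||]; rewrite ?hE /= ?g10 ?add0r //.
  + exact: bea.
  + by case: def => -[]; lra.
  + by rewrite !min_l ?addr0 //; case: def => -[]; lra.
- have [p pq] := atom_neq q; have := ha2 q; have := ha1 q.
  rewrite g2t => /andP[_ q10] /andP[_ q20].
  (* At an atom [t = q], [h] is [g1 q <= 0] at [q] and [g2 DTop >= 0] at every other atom, so the
     peak goes off [q] and only [beta] survives in the negative part. *)
  exists p, (g2 DTop), (g1 (DAtom q)).
  split=> [||a ap||]; rewrite ?hE /= ?(negPf pq) ?g10 ?add0r //.
  + by lra.
  + by case: eqVneq => [->|_] /=; rewrite ?eqxx ?g2t ?g10; lra.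
  + by rewrite addrC.
  + by rewrite min_l // min_r // add0r.
- have [p [q [al [be [ba alp bea def]]]]] := peak_of_submodular s1 g10.
  have /andP[q0 q1] := ha1 q.
  exists p, al, be; split=> // [|a ap||]; rewrite ?hE /= ?g2t ?addr0 //.
  + exact: bea.
  + by case: def => -[]; lra.
  + by rewrite !min_r; case: def => -[]; lra.
Qed.

(** Distinct atoms use the peak at most once, so the best pair is [p] with any other atom. *)
Lemma max_pair_sum_peak (u : A -> R) p beta :
    (forall a, a != p -> u a = beta) -> beta <= u p ->
  max_pair_sum u = u p + beta.
Proof.
move=> ub bp; have [[a [b [ab maxE]]] umax] := max_pair_sumP u hA2.
have [c cp] := atom_neq p; apply: le_anti; apply/andP; split; last first.
  by rewrite -(ub c cp); apply: umax; rewrite eq_sym.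
rewrite maxE; case: (eqVneq a p) (eqVneq b p) => [ap|ap] [bp'|bp'].
- by rewrite ap bp' eqxx in ab.
- by rewrite ap (ub b).
- by rewrite bp' (ub a) // addrC.
- by rewrite (ub a) // (ub b) // lerD2r.
Qed.

Lemma max_pair_sum_homo (u v : A -> R) :
  (forall a, u a <= v a) -> max_pair_sum u <= max_pair_sum v.
Proof.
move=> uv; have [[a [b [ab ->]]] _] := max_pair_sumP u hA2.
have [_ vmax] := max_pair_sumP v hA2.
by apply: le_trans (vmax a b ab); rewrite lerD.
Qed.

End OneCoordinate.

(** * Weak duality and the optimal vector *)

Section Vectors.
Variables (R : realType) (A : finType) (n : nat).
Hypothesis hA : (3 <= #|A|)%N.
Local Notation Mn := (n.-tupleprod (diamond A)).
Implicit Types (x z : {ffun 'I_n * A -> R}) (y : Mn).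

Lemma vec_eval_homo x z y :
  (forall ia, x ia <= z ia) -> vec_eval x y <= vec_eval z y.
Proof.
move=> xz; apply: ler_sum => i _; case: (tnth y i) => [|a|] //=.
exact: max_pair_sum_homo.
Qed.

Lemma neg_part_le x ia : neg_part x ia <= x ia.
Proof. by rewrite ffunE ge_min lexx orbT. Qed.

Lemma nonpositive_neg_part x : nonpositive (neg_part x).
Proof. by move=> ia; rewrite ffunE ge_min lexx. Qed.

Lemma tnth_top i : tnth (\top%O : Mn) i = DTop.
Proof. by rewrite topEtprod tnth_mktuple. Qed.

Lemma tnth_bot i : tnth (\bot%O : Mn) i = DBot.
Proof. by rewrite botEtprod tnth_mktuple. Qed.

(** In each coordinate the value at the top is the peak plus the common value; both are nonpositive,
    so dropping either or both cannot decrease it. *)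
Lemma vec_eval_top_min z y :
  nonpositive z -> unified z -> vec_eval z (\top)%O <= vec_eval z y.
Proof.
move=> z0 uz; apply: ler_sum => i _; rewrite tnth_top /=.
have [p [zeq zp]] := uz i; have [c cp] := atom_neq hA p.
rewrite (max_pair_sum_peak hA (p := p) (beta := z (i, c))) => //; last first.
  by move=> a ap; exact: zeq.
have zp0 := z0 (i, p); have zc0 := z0 (i, c).
case: (tnth y i) => [|a|] /=; first by lra.
  by case: (eqVneq a p) => [->|ap]; [|rewrite (zeq a c)//]; lra.
rewrite (max_pair_sum_peak hA (p := p) (beta := z (i, c))) => //.
by move=> a ap; exact: zeq.
Qed.

Lemma unified_base_exists (f : Mn -> R) (t : Mn) :
    submodular f -> f \bot%O = 0 -> (forall y, f t <= f y) ->
  exists x, [/\ baseM f x, unified (neg_part x)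
              & vec_eval (neg_part x) \top%O = f t].
Proof.
move=> sf f0 tmin.
pose fl := lower_envelope f; pose fu := upper_envelope f.
have slo : submodular fl := lower_envelope_submodular sf.
have sup : submodular fu := upper_envelope_submodular sf.
have fl0 : fl \bot%O = 0 by rewrite -f0; exact: lower_envelope_bot.
have flt : fl t = f t.
  apply: le_anti; rewrite lower_envelope_le /=.
  have [u _ [fE _]] := lower_envelopeP f t; rewrite /fl fE; exact: tmin.
have fut : fu t = f t.
  apply: le_anti; rewrite upper_envelope_le /=.
  have [u _ [fE _]] := upper_envelopeP f t; rewrite /fu fE; exact: tmin.
pose g1 := marginal fl \bot%O t; pose g2 := marginal fu t \top%O.
have f_ge y : fl (y `&` t)%O + fu (y `|` t)%O <= f y + f t.
  apply: le_trans (sf y t); apply: lerD; first exact: lower_envelope_le.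
  exact: upper_envelope_le.
pose h i m := g1 i (m `&` tnth t i)%O + g2 i (m `|` tnth t i)%O.
(* Adding the two greedy bounds gives the left side of [f_ge] minus [f t], since [fl] vanishes at
   the bottom and [fu t = f t]. *)
have sum_h y : \sum_i h i (tnth y i) <= f y.
  rewrite big_split /=.
  have le1 : \sum_i g1 i (tnth y i `&` tnth t i)%O <=
      fl (y `&` t)%O - fl \bot%O.
    rewrite (eq_bigr (fun i => g1 i (tnth (y `&` t)%O i))) => [|i _].
      exact: (sum_marginal_le slo (le0x _) (leIr _ _)).
    by rewrite tnth_meet.
  have le2 : \sum_i g2 i (tnth y i `|` tnth t i)%O <= fu (y `|` t)%O - fu t.
    rewrite (eq_bigr (fun i => g2 i (tnth (y `|` t)%O i))) => [|i _].
      exact: (sum_marginal_le sup (leUr _ _) (lex1 _)).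
    by rewrite tnth_join.
  by have := f_ge y; move: le1 le2; rewrite fl0 fut; lra.
have g1_bot i : g1 i DBot = 0 by rewrite -(tnth_bot i); exact: marginal_bottom.
have g2_t i : g2 i (tnth t i) = 0 by exact: marginal_bottom.
have sum_g1 : \sum_i g1 i (tnth t i) = f t.
  by rewrite sum_marginal_top flt fl0 subr0.
(* Both greedy sums are exact at the ends of their chains: they give [f t] and [f \top - f t]. *)
have sum_h_top : \sum_i h i DTop = f \top%O.
  rewrite big_split /= -[RHS](subrK (fu t)) -[X in X - _](upper_envelope_top f).
  rewrite -sum_marginal_top fut -sum_g1 addrC; congr (_ + _).
  by apply: eq_bigr => i _; rewrite tnth_top diamond_joinE; case: (tnth t i).
have peak i : exists w : A * R * R,
    [/\ w.2 <= w.1.2, w.1.2 <= h i (DAtom w.1.1),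
        forall a, a != w.1.1 -> w.2 <= h i (DAtom a),
        w.1.2 + w.2 = h i DTop
      & Num.min 0 w.1.2 + Num.min 0 w.2 = g1 i (tnth t i)].
  have [] := @peak_of_pair _ _ hA (g1 i) (g2 i) (tnth t i).
  - exact: marginal_submodular.
  - exact: marginal_submodular.
  - move=> m m' mm'; rewrite lerD2r.
    exact/lower_envelope_anti/chain_step_homo.
  - move=> m m' mm'; rewrite lerD2r.
    exact/upper_envelope_homo/chain_step_homo.
  - exact: g1_bot.
  - exact: g2_t.
  by move=> p [al [be H]]; exists (p, al, be).
(* [w i] packs the peak atom, the peak value and the common value of coordinate [i]. *)
have /choice[w wP] := peak.
pose x : {ffun 'I_n * A -> R} :=
  [ffun ia => if ia.2 == (w ia.1).1.1 then (w ia.1).1.2 else (w ia.1).2].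
have x_peak i : x (i, (w i).1.1) = (w i).1.2 by rewrite ffunE eqxx.
have x_off i a : a != (w i).1.1 -> x (i, a) = (w i).2.
  by rewrite ffunE /= => /negPf->.
have x_top i : max_pair_sum (fun a => x (i, a)) = h i DTop.
  have [ba _ _ <- _] := wP i.
  by rewrite (max_pair_sum_peak hA (x_off i)) x_peak.
have nx_off i a : a != (w i).1.1 -> neg_part x (i, a) = Num.min 0 (w i).2.
  by move=> ai; rewrite ffunE x_off.
(* Truncation at [0] is monotone, so the negative part keeps its peak at the same atom. *)
have nx_le i : Num.min 0 (w i).2 <= neg_part x (i, (w i).1.1).
  by have [ba _ _ _ _] := wP i; rewrite ffunE x_peak le_min2.
exists x; split; first split.
- move=> y; apply: le_trans (sum_h y); apply: ler_sum => i _.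
  have [_ alp bea _ _] := wP i.
  case: (tnth y i) => [|a|] /=; last by rewrite x_top.
    by rewrite /h (meet0x (tnth t i)) (join0x (tnth t i)) g1_bot g2_t addr0.
  by case: (eqVneq a (w i).1.1) => [->|ai]; rewrite ?x_peak // x_off // bea.
- by rewrite -sum_h_top; apply: eq_bigr => i _; rewrite tnth_top -x_top.
- move=> i; exists (w i).1.1; split=> [a b ai bi|a]; first by rewrite !nx_off.
  by case: (eqVneq a (w i).1.1) => [->|ai] //; rewrite nx_off.
rewrite -sum_g1; apply: eq_bigr => i _; rewrite tnth_top /=.
have [_ _ _ _ <-] := wP i.
by rewrite (max_pair_sum_peak hA (nx_off i)) // ffunE x_peak.
Qed.

End Vectors.

Theorem theorem2 (R : realType) (A : finType) (hA : (3 <= #|A|)%N)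
    (n : nat) (hn : (1 <= n)%N) (f : n.-tupleprod (diamond A) -> R)
    (hf : submodular f) (hf0 : f (\bot)%O = 0) :
  exists m : R,
    [/\ is_minimum (range f) m,
        is_maximum [set vec_eval z (\top)%O | z in
          [set z : {ffun 'I_n * A -> R} |
            [/\ polyM f z, nonpositive z & unified z]]] m
      & is_maximum [set vec_eval (neg_part x) (\top)%O | x in
          [set x : {ffun 'I_n * A -> R} |
            baseM f x /\ unified (neg_part x)]] m].
Proof.
pose t := [arg min_(y < \bot%O) f y]%O.
have tmin y : f t <= f y by rewrite /t; case: arg_minP => // i _; apply.
(* Weak duality: the value at the top is at most the value at [t], which is at most [f t]. It bounds
   both maxima, the second through [neg_poly]. *)
have dual z : polyM f z -> nonpositive z -> unified z ->
    vec_eval z (\top)%O <= f t.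
  by move=> zP z0 uz; apply: le_trans (zP t); exact: vec_eval_top_min.
have neg_poly x : polyM f x -> polyM f (neg_part x).
  move=> xP y; apply: le_trans (xP y); apply: vec_eval_homo => // ia.
  exact: neg_part_le.
have [x [[xP xB] ux xt]] := unified_base_exists hA hf hf0 tmin.
exists (f t); split.
- by split=> [|_ [y _ <-]]; [exists t | exact: tmin].
- split=> [|_ [z [zP z0 uz] <-]]; last exact: dual.
  exists (neg_part x) => //; split=> //; first exact: neg_poly.
  exact: nonpositive_neg_part.
- split=> [|_ [z [[zP _] uz] <-]]; first by exists x.
  by apply: dual => //; [exact: neg_poly | exact: nonpositive_neg_part].
Qed.
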